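(* Every outerplanar graph belongs to $c$-$\textsc{And}(1)$.
   Context: All graphs are finite, simple and connected. A $c$-$\textsc{And}(1)$-realization of a graph $G=(V,E)$ is a family $\{([L(v),R(v)],p_v):v\in V\}$ of closed real intervals with $p_v=(L(v)+R(v))/2$ such that for distinct $u,v$: $uv\in E$ iff $p_v\in[L(u),R(u)]$ and $p_u\in[L(v),R(v)]$. $c$-$\textsc{And}(1)$ is the class of graphs admitting a $c$-$\textsc{And}(1)$-realization. *)

(* Defs.v *)
From HB Require Import structures.
From mathcomp Require Import all_boot all_order all_algebra.
From mathcomp Require Import all_classical all_reals all_analysis.
Set Implicit Arguments.
Unset Strict Implicit.
Unset Printing Implicit Defensive.
Import Order.TTheory GRing.Theory Num.Theory.
Import numFieldNormedType.Exports.
Local Open Scope classical_set_scope.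
Local Open Scope ring_scope.

Record simple_graph (V : finType) (e : rel V) : Prop := SimpleGraph {
  adj_sym : symmetric e;
  adj_irrefl : irreflexive e }.

Definition connected_graph (V : finType) (e : rel V) : Prop :=
  forall u v : V, connect e u v.

(* The plane is R * R. The values of arc u v outside [0, 1], and those of
   arc u v when uv is not an edge, are irrelevant. An undirected edge is seen
   as two ordered pairs, whose arcs must trace the same curve. *)
Record plane_drawing (R : realType) (V : finType) (e : rel V)
    (pos : V -> R * R) (arc : V -> V -> R -> R * R) : Prop := PlaneDrawing {
  pos_inj : injective pos;
  arc_continuous : forall u v, e u v ->
    {within `[0, 1], continuous (arc u v)};
  arc_inj : forall u v, e u v -> {in `[0, 1] &, injective (arc u v)};
  arc_source : forall u v, e u v -> arc u v 0 = pos u;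
  arc_target : forall u v, e u v -> arc u v 1 = pos v;
  arc_sym : forall u v, e u v -> arc u v @` `[0, 1] = arc v u @` `[0, 1];
  arc_avoids_vertices : forall u v w (t : R), e u v -> t \in `]0, 1[ ->
    arc u v t <> pos w;
  arc_noncrossing : forall u v u' v' (t t' : R), e u v -> e u' v' ->
    (u', v') <> (u, v) -> (u', v') <> (v, u) ->
    t \in `]0, 1[ -> t' \in `]0, 1[ -> arc u v t <> arc u' v' t' }.

Definition drawing_set (R : realType) (V : finType) (e : rel V)
    (pos : V -> R * R) (arc : V -> V -> R -> R * R) : set (R * R) :=
  [set x | (exists v, x = pos v) \/
           (exists u v, e u v /\ (arc u v @` `[0, 1]) x)].

(* The complement of the compact set D has exactly one unbounded component.
   For x in D the component below is empty, hence bounded. *)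
Definition outer_face (R : realType) (D : set (R * R)) : set (R * R) :=
  [set x | ~ bounded_set (connected_component (~` D) x)].

(* Faces are open, so a vertex lies on the outer face, i.e., on its boundary,
   when it is in the closure of that face. *)
Definition outerplanar (R : realType) (V : finType) (e : rel V) : Prop :=
  exists (pos : V -> R * R) (arc : V -> V -> R -> R * R),
    plane_drawing e pos arc /\
    forall v, closure (outer_face (drawing_set e pos arc)) (pos v).

Definition midpoint (R : realType) (a b : R) : R := (a + b) / 2.

(* The interval of the vertex v is [lo v, hi v]. *)
Definition cAnd1_realization (R : realType) (V : finType) (e : rel V)
    (lo hi : V -> R) : Prop :=
  (forall v, lo v <= hi v) /\
  (forall u v, u <> v ->
     (e u v <->
      midpoint (lo v) (hi v) \in `[lo u, hi u] /\
      midpoint (lo u) (hi u) \in `[lo v, hi v])).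

Definition cAnd1 (R : realType) (V : finType) (e : rel V) : Prop :=
  exists lo hi : V -> R, cAnd1_realization e lo hi.

(* Main.v *)
Require Import Defs.
From mathcomp Require Import all_boot all_order all_algebra.
From mathcomp Require Import all_classical all_reals all_analysis.
From mathcomp Require Import ring lra.
From Stdlib Require Import Btauto.
Set Implicit Arguments.
Unset Strict Implicit.
Unset Printing Implicit Defensive.
Import Order.TTheory GRing.Theory Num.Theory.
Import numFieldNormedType.Exports.

(** Join every vertex [u] to one common point of the outer face by a polygonal
    path [g u] which, apart from its start, stays in that face. Replacing the
    arcs of the drawing by fine polygonal approximations, two disjoint edges,
    or a path [g u] and an edge not incident to [u], do not meet. Counting
    modulo 2 how often such a polygonal path, seen from a given point, turns
    across a fixed half-line, the disjointness relations add up to a tournament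
    [t] on the vertices with
      [t u w + t u x + t v w + t v x = 0 (mod 2)]
    for all disjoint edges [uv], [wx]. This replaces the Jordan curve theorem:
    if [t] is transitive, the relation says that the edges do not cross when
    the vertices are put on a line in the order [t].

    In general the relation still gives a recursive decomposition. Start from a
    root; given two placed vertices [a], [b] and a set [S] of vertices to be
    placed between them, having no neighbours outside [S], [a] and [b], take
    the last neighbour [w] of [a] in a suitable component of [S]; it splits
    [S - w] into a part with no neighbours outside [a], [w] and a part with no
    neighbours outside [w], [b]. Placing [w] near the middle of the gap, and
    giving each vertex the distance to its farthest neighbour as radius, yields
    the realization. *)

(** * Splitting a gap *)

Definition tournament (V : eqType) (t : rel V) : Prop :=
  forall x y, x != y -> t x y = ~~ t y x.

Definition within (V : finType) (e : rel V) (S : pred V) : rel V :=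
  [rel x y | [&& S x, S y & e x y]].

(** [S] is a set of vertices to be placed in the gap between two vertices [a]
    and [b], which enter only through their neighbours [A] and [B] in [S]. The
    value [t x y] is meant as "[x] comes before [y]", but carries information
    only when [x] and [y] lie in the same component of [S]. *)
Record gap (V : finType) (e t : rel V) (S A B : pred V) : Prop := Gap {
  gap_left : forall x, A x -> S x;
  gap_right : forall x, B x -> S x;
  gap_leave : forall X : pred V, (forall x, X x -> S x) -> (exists x, X x) ->
    exists x, X x /\ [\/ A x, B x | exists y, [/\ S y, ~~ X y & e x y]];
  gap_edges : forall x y p q, within e S x y -> within e S p q ->
    [&& x != p, x != q, y != p & y != q] -> connect (within e S) x p ->
    t x p (+) t x q = t y p (+) t y q;
  gap_left_edge : forall x p q, A x -> within e S p q -> x != p -> x != q ->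
    connect (within e S) x p -> t x p = t x q;
  gap_right_edge : forall x p q, B x -> within e S p q -> x != p -> x != q ->
    connect (within e S) x p -> t x p = t x q;
  gap_left_right : forall x p, A x -> B p -> x != p ->
    connect (within e S) x p -> t x p;
  gap_both_uniq : forall x x' y y', A x -> A x' -> B y -> B y' ->
    connect (within e S) x y -> connect (within e S) x' y' ->
    connect (within e S) x x' }.

(** [S1] is meant for the gap between [a] and [w], [S2] for that between [w] and [b]; the fields
    ensure that no edge between two other vertices jumps over [w]. *)
Record gap_split (V : finType) (e : rel V) (S A B : pred V) (w : V)
    (S1 S2 : pred V) : Prop := GapSplit {
  split_mem : forall x, S x = [|| x == w, S1 x | S2 x];
  split_left_nw : ~~ S1 w;
  split_right_nw : ~~ S2 w;
  split_disj : forall x, S1 x -> ~~ S2 x;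
  split_noedge : forall x y, S1 x -> S2 y -> ~~ e x y;
  split_left : forall x, A x -> x != w -> S1 x;
  split_right : forall x, B x -> x != w -> S2 x }.

Lemma within_sym (V : finType) (e : rel V) (S : pred V) :
  symmetric e -> symmetric (within e S).
Proof. by move=> se x y; rewrite /within /= se andbCA. Qed.

Lemma within_connect_sym (V : finType) (e : rel V) (S : pred V) :
  symmetric e -> connect_sym (within e S).
Proof. by move=> se; apply: sym_connect_sym; apply: within_sym. Qed.

Lemma within_connect_sub (V : finType) (e : rel V) (S S' : pred V) x y :
  (forall z, S z -> S' z) -> connect (within e S) x y ->
  connect (within e S') x y.
Proof.
move=> SS'; apply: connect_sub => p q /and3P[Sp Sq epq]; apply: connect1.
by rewrite /within /= !SS'.
Qed.

Lemma connect_const (V : finType) (T : Type) (r : rel V) (f : V -> T) x y :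
  (forall p q, connect r x p -> r p q -> f p = f q) ->
  connect r x y -> f x = f y.
Proof.
move=> fE /connectP[s]; elim: s x fE => [|z s IH] x fE /=; first by move=> _ ->.
case/andP=> rxz pzs yE; have -> : f x = f z by exact: fE (connect0 _ _) rxz.
apply: IH => // p q zp.
by apply: fE; apply: connect_trans zp; apply: connect1.
Qed.

(** Lets arguments made at the left end serve at the right end. *)
Lemma gap_rev (V : finType) (e t : rel V) (S A B : pred V) :
  symmetric e -> tournament t -> gap e t S A B ->
  gap e (fun x y => t y x) S B A.
Proof.
move=> se tt [SA SB L E1 E2 E3 E4 U]; have cs := within_connect_sym S se.
split=> //.
- move=> X XS X0; have [x [Xx H]] := L X XS X0; exists x; split=> //.
  by case: H; [constructor 2 | constructor 1 | constructor 3].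
- move=> x y p q xy pq /and4P[n1 n2 n3 n4] xp.
  have := E1 p q x y pq xy; rewrite (eq_sym p) (eq_sym p) (eq_sym q) (eq_sym q).
  rewrite n1 n2 n3 n4 cs xp => /(_ isT isT).
  by case: (t p x) (t p y) (t q x) (t q y) => [] [] [] [].
- move=> x p q Bx pq xp xq c; rewrite tt 1?eq_sym // (tt q) 1?eq_sym //.
  by rewrite (E3 x p q).
- move=> x p q Bx pq xp xq c; rewrite tt 1?eq_sym // (tt q) 1?eq_sym //.
  by rewrite (E2 x p q).
- by move=> x p Bx Ap xp c; apply: E4; rewrite // 1?eq_sym // cs.
- move=> x x' y y' Bx Bx' Ay Ay' xy xy'.
  have := U y y' x x' Ay Ay' Bx Bx'; rewrite cs xy cs xy' => /(_ isT isT) yy'.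
  by apply: connect_trans xy (connect_trans yy' _); rewrite cs.
Qed.

Lemma gap_split_rev (V : finType) (e : rel V) (S A B : pred V) w S1 S2 :
  symmetric e -> gap_split e S A B w S1 S2 -> gap_split e S B A w S2 S1.
Proof.
move=> se [Sm n1 n2 d ne l r]; split=> //.
- by move=> x; rewrite Sm (orbC (S1 x)).
- by move=> x; apply: contraL; apply: d.
- by move=> x y S2x S1y; rewrite se; apply: ne.
Qed.

(** The conditions at the new right end [w] come from [gap_edges] for an edge from [w] to [x]: its
    two terms at [w] cancel, because both ends of the other edge come before [w]. *)
Lemma split_gap_left (V : finType) (e t : rel V) (S A B : pred V) w S1 S2 :
  symmetric e -> tournament t -> gap e t S A B ->
  gap_split e S A B w S1 S2 ->
  (forall x, S1 x -> connect (within e S) w x -> t x w) ->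
  gap e t S1 [pred x | S1 x && A x] [pred x | S1 x && e w x].
Proof.
move=> se tt [SA SB L E1 E2 E3 E4 U] [Sm n1 n2 d ne l r] tw.
have cs := within_connect_sym S se; have cs1 := within_connect_sym S1 se.
have Sw : S w by rewrite Sm eqxx.
have S1S x : S1 x -> S x by rewrite Sm => ->; rewrite orbT.
have w1S x y : within e S1 x y -> within e S x y.
  by case/and3P=> /S1S Sx /S1S Sy exy; apply/and3P.
have c1S x y : connect (within e S1) x y -> connect (within e S) x y.
  exact: within_connect_sub.
have S1nw x : S1 x -> x != w by move=> S1x; apply: contraTneq S1x => ->.
have ww x : S1 x -> e w x -> within e S w x.
  by move=> S1x wx; apply/and3P; split=> //; exact: S1S.
split.
- by move=> x /andP[].
- by move=> x /andP[].
- move=> X XS X0; have [] := L X _ X0; first by move=> x /XS /S1S.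
  move=> x [Xx H]; exists x; split=> //; have S1x := XS _ Xx; case: H.
  + by move=> Ax; constructor 1; rewrite /= S1x.
  + move=> Bx; have S2x : S2 x by apply: r => //; apply: S1nw.
    by have := d _ S1x; rewrite S2x.
  + case=> y [Sy Xy xy]; have := Sy; rewrite Sm => /or3P[/eqP yw|S1y|S2y].
    * by constructor 2; rewrite /= S1x se -yw.
    * by constructor 3; exists y.
    * by have := ne _ _ S1x S2y; rewrite xy.
- by move=> x y p q /w1S xy /w1S pq n /c1S; apply: E1.
- by move=> x p q /andP[_ Ax] /w1S pq xp xq /c1S; apply: E2.
- move=> x p q /andP[S1x wx] pq xp xq xcp.
  have /and3P[S1p S1q _] := pq.
  have wcx : connect (within e S) w x by apply: connect1; apply: ww.
  have wcp := connect_trans wcx (c1S _ _ xcp).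
  have wcq := connect_trans wcp (connect1 (w1S _ _ pq)).
  have := E1 w x p q (ww _ S1x wx) (w1S _ _ pq).
  rewrite (eq_sym w) (eq_sym w) (S1nw p) // (S1nw q) // xp xq => /(_ isT wcp).
  rewrite (tt w p) 1?eq_sym ?S1nw // (tt w q) 1?eq_sym ?S1nw // !tw //.
  by case: (t x p) (t x q) => [] [].
- move=> x p /andP[S1x Ax] /andP[S1p wp] xp xcp.
  have wcp : connect (within e S) w p by apply: connect1; apply: ww.
  have wcx : connect (within e S) w x.
    by apply: connect_trans wcp _; rewrite cs; apply: c1S.
  rewrite (E2 x p w) ?tw // ?S1nw //; last exact: c1S.
  by rewrite (within_sym S se); apply: ww.
- move=> x x' y y' /andP[S1x Ax] /andP[S1x' Ax'] /andP[S1y wy] /andP[S1y' wy'].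
  move=> xy xy'; apply/negPn/negP => nxx'.
  (* Suppose two components of [S1] are attached to both [a] and [w]. Moving [v] along its component
     and then on to [w] does not change [t u v], so [u] comes before [v]; by symmetry [v] comes
     before [u]. *)
  have half u v z : S1 u -> A u -> S1 v -> S1 z -> e w z ->
      connect (within e S) w u -> connect (within e S1) v z ->
      ~~ connect (within e S1) u v -> t u v.
    move=> S1u Au S1v S1z wz wcu vz nuv.
    have nu p : connect (within e S1) v p -> u != p.
      by apply: contraTneq => <-; rewrite cs1.
    have wcz : connect (within e S) w z by apply: connect1; apply: ww.
    have ucz : connect (within e S) u z.
      by apply: connect_trans wcz; rewrite cs.
    have -> : t u v = t u z.
      apply: (@connect_const _ _ (within e S1) _ _ _ _ vz) => p q vp pq.
      apply: E2 => //; [exact: w1S | exact: nu | apply: nu | ].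
        by apply: connect_trans vp _; apply: connect1.
      apply: connect_trans ucz _; rewrite cs; apply: c1S.
      by apply: connect_trans _ vz; rewrite cs1.
    have -> : t u z = t u w; last exact: tw.
    apply: E2 => //; [ | exact: nu | exact: S1nw].
    by rewrite (within_sym S se); apply: ww.
  have cw u z : S1 z -> e w z -> connect (within e S1) u z ->
      connect (within e S) w u.
    move=> S1z wz uz; apply: connect_trans (connect1 (ww _ S1z wz)) _.
    by rewrite cs; apply: c1S.
  have t1 := half x x' y' S1x Ax S1x' S1y' wy' (cw _ _ S1y wy xy) xy' nxx'.
  have := half x' x y S1x' Ax' S1x S1y wy (cw _ _ S1y' wy' xy') xy.
  rewrite cs1 nxx' tt ?t1; first by move/(_ isT).
  by apply: contraNneq nxx' => ->.
Qed.

(** The suitable component is the one attached to both ends, unique by [gap_both_uniq], or, failing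
    that, any one attached to [a]. Its vertices go left or right as they come before or after [w].
    Any other component goes left as a whole if it contains a neighbour of [a], and right
    otherwise. *)
Lemma gap_splitting_left (V : finType) (e t : rel V) (S A B : pred V) :
  symmetric e -> tournament t -> gap e t S A B -> (exists x, A x) ->
  exists w S1 S2, [/\ gap_split e S A B w S1 S2,
    gap e t S1 [pred x | S1 x && A x] [pred x | S1 x && e w x] &
    gap e t S2 [pred x | S2 x && e w x] [pred x | S2 x && B x]].
Proof.
move=> se tt G A0; have [SA SB L E1 E2 E3 E4 U] := G.
have cs := within_connect_sym S se.
pose cn := connect (within e S).
have [w0 Aw0 w0P] : exists2 w0, A w0 &
    forall x y, A x -> B y -> cn x y -> cn w0 x.
  case: (pselect (exists x y, [/\ A x, B y & cn x y])) =>
    [[w [z [Aw Bz wz]]]|n].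
    by exists w => // x y Ax By xy; apply: (U w x z y).
  case: A0 => w Aw; exists w => // x y Ax By xy; case: n.
  by exists x, y.
(* Of the neighbours of [a] in the component of [w0], the last one is the one
   with the most vertices of that component before it. *)
pose m (w : V) := #|[pred x | [&& cn w0 x, x != w & t x w]]|.
have Pw0 : A w0 && cn w0 w0 by rewrite Aw0 /cn connect0.
case: (@arg_maxnP _ w0 [pred w | A w && cn w0 w] m Pw0) => w /andP[Aw w0w] wmax.
(* If [w'] came after [w], it would have before it [w] and all that comes before [w], against the
   maximality of [w]. *)
have {}wmax w' : A w' -> cn w w' -> w' != w -> t w' w.
  move=> Aw' ww' nw; apply/negPn/negP => tw'.
  have tww' : t w w' by rewrite tt 1?eq_sym.
  have w0w' : cn w0 w' by apply: connect_trans ww'.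
  have := wmax w'; rewrite /= Aw' w0w' => /(_ isT).
  rewrite leqNgt => /negP; apply.
  apply: proper_card; apply/properP; split; last first.
    by exists w; rewrite !inE /= ?eqxx ?andbF // w0w eq_sym nw.
  apply/fintype.subsetP => x; rewrite !inE => /and3P[w0x xw txw].
  have xw' : x != w' by apply: contraTneq txw => ->.
  rewrite w0x xw' /=.
  (* [t^~ w] is constant on the components of [S - w] and takes different
     values at [x] and [w'], so a path from [x] to [w] avoids [w']; and along
     it [t^~ w'] is constant. *)
  have xcw : cn x w by apply: connect_trans w0w; rewrite /cn cs.
  pose T := [pred z | S z && (z != w')].
  have : connect (within e T) x w.
    have/connectP[s] := xcw.
    elim: s x xw xw' txw {w0x xcw} => [|y s IH] x xw xw' txw /=.
      by move=> _ wE; rewrite wE eqxx in xw.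
    case/andP=> xy ys wE.
    have /and3P[Sx Sy exy] := xy.
    have wcx : cn w x.
      rewrite /cn cs; apply/connectP; exists (y :: s) => //=.
      by rewrite xy.
    have [yw|yw] := eqVneq y w.
      rewrite yw in Sy exy; apply: connect1.
      by rewrite /within /= Sx Sy xw' exy eq_sym nw.
    have tyw : t y w.
      rewrite tt //; rewrite tt // in txw.
      by rewrite -(E2 w x y Aw xy) // eq_sym.
    have yw' : y != w' by apply: contraTneq tyw => ->.
    apply: connect_trans (IH y yw yw' tyw ys wE); apply: connect1.
    by rewrite /within /= Sx Sy xw' yw'.
  move=> xTw; suff -> : t x w' = t w w' by [].
  apply: (@connect_const _ _ (within e T) (t^~ w') _ _ _ xTw) => p q xp.
  case/and3P=> /andP[Sp pw'] /andP[Sq qw'] epq.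
  rewrite tt // (tt q) //; congr negb; apply: E2 => //.
  - by rewrite /within /= Sp Sq.
  - by rewrite eq_sym.
  - by rewrite eq_sym.
  - rewrite cs; apply: connect_trans (_ : cn p w) ww'.
    apply: connect_trans xcw; rewrite /cn cs.
    by apply: within_connect_sub xp => z /andP[].
have Sw : S w := SA _ Aw.
pose attA x := [exists y, A y && cn x y].
(* Beware that [t] does not compare vertices of different components. *)
pose S1 := [pred x | [&& S x, x != w & if cn w x then t x w else attA x]].
pose S2 := [pred x | [&& S x, x != w & ~~ S1 x]].
have sp : gap_split e S A B w S1 S2.
  split.
  - move=> x; rewrite /S2 /S1 /=; case: eqVneq => [->|]; rewrite ?Sw //=.
    by case: (S x) => //=; case: (if _ then _ else _).
  - by rewrite /S1 /= eqxx andbF.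
  - by rewrite /S2 /= eqxx andbF.
  - by move=> x S1x; apply/negP => /and3P[_ _ /negP]; apply.
  - move=> x y /and3P[Sx xw xP] /and3P[Sy yw]; rewrite /S1 /= Sy yw /=.
    apply: contra => exy; have xy : within e S x y by apply/and3P.
    have cxy : cn x y by apply: connect1.
    have -> : cn w y = cn w x.
      apply/idP/idP => H; apply: (connect_trans H) => //.
      by rewrite cs.
    move: xP; case: ifP => wx.
      by rewrite (tt y) // (tt x) // (E2 w x y) // eq_sym.
    case/existsP=> z /andP[Az xz]; apply/existsP; exists z; rewrite Az /=.
    by apply: connect_trans xz; rewrite /cn cs.
  - move=> x Ax xw; rewrite /S1 /= SA // xw /=.
    case: ifP => wx; first exact: wmax.
    by apply/existsP; exists x; rewrite Ax /cn connect0.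
  - move=> x Bx xw; rewrite /S2 /S1 /= SB // xw /=; case: ifP => wx.
      by rewrite -tt 1?eq_sym // E4 // eq_sym.
    apply/negP => /existsP[z /andP[Az xz]]; move/negP: wx; apply.
    have zx : cn z x by rewrite /cn cs.
    apply: connect_trans (_ : cn w w0) _; first by rewrite /cn cs.
    by apply: connect_trans (w0P z x Az Bx zx) zx.
exists w, S1, S2; split=> //.
  apply: split_gap_left sp _ => // x /and3P[Sx xw].
  by rewrite -/(cn w x) => + H; rewrite H.
have tt' : tournament (fun x y => t y x).
  by move=> x y xy; rewrite tt // eq_sym.
apply: (gap_rev se tt').
apply: (split_gap_left se tt' (gap_rev se tt G) (gap_split_rev se sp)).
move=> x /and3P[Sx xw nS1] wx; have := nS1; rewrite /S1 /= Sx xw /=.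
by rewrite [cn w x]wx (tt x w) // negbK.
Qed.

(** By [gap_leave] for all of [S], one of the ends has a neighbour; if it is the right end, the gap
    is reversed. *)
Lemma gap_splitting (V : finType) (e t : rel V) (S A B : pred V) :
  symmetric e -> tournament t -> gap e t S A B -> (exists x, S x) ->
  exists w S1 S2, [/\ gap_split e S A B w S1 S2,
    gap e t S1 [pred x | S1 x && A x] [pred x | S1 x && e w x] &
    gap e t S2 [pred x | S2 x && e w x] [pred x | S2 x && B x]].
Proof.
move=> se tt G S0; have [x [Sx H]] := gap_leave G (fun _ => id) S0.
have {H} [Ax|Bx] : A x \/ B x.
  by case: H => [||[y [-> /negP []]]]; [left|right|].
  by apply: gap_splitting_left => //; exists x.
have tt' : tournament (fun x y => t y x).
  by move=> p q pq; rewrite tt // eq_sym.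
have [|w [S2 [S1 [sp G2 G1]]]] := gap_splitting_left se tt' (gap_rev se tt G).
  by exists x.
exists w, S1, S2; split; first exact: gap_split_rev.
  exact: (gap_rev se tt').
exact: (gap_rev se tt').
Qed.

(** * The gap at the root *)

Lemma connect_leave (V : finType) (e : rel V) (X : pred V) x y :
  connect e x y -> X x -> ~~ X y -> exists p q, [/\ X p, ~~ X q & e p q].
Proof.
move=> xy Xx nXy; apply: contrapT => nex; case/negP: nXy.
have {xy} /connectP[s] := xy.
elim: s x Xx => [|z s IH] x Xx /=; first by move=> _ ->.
case/andP=> exz zs yE; apply: (IH z) => //; apply: contrapT => /negP nXz.
by apply: nex; exists x, z.
Qed.

Definition parity_drawn (V : finType) (e t : rel V) : Prop :=
  forall u v w x, e u v -> e w x -> [&& u != w, u != x, v != w & v != x] ->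
  t u w (+) t u x = t v w (+) t v x.

(** Switching keeps the parity relation, since the correction at each of the four vertices enters
    twice. The edge condition at the left end is the parity relation for an edge at [c]. *)
Lemma root_gap (V : finType) (e t : rel V) (c : V) :
  simple_graph e -> connected_graph e -> tournament t -> parity_drawn e t ->
  exists2 t', tournament t' & gap e t' (predC1 c) (e c) pred0.
Proof.
move=> [se ie] ce tt pt.
(* Switching at [c] makes [c] the first vertex. *)
exists (fun x y => t x y (+) t x c (+) t y c).
  move=> x y xy; rewrite tt //.
  by case: (t y x) (t x c) (t y c) => [] [] [].
split=> //.
- by move=> x ecx; apply/eqP => xc; rewrite xc ie in ecx.
- move=> X XS [x Xx].
  have nXc : ~~ X c by apply/negP => /XS /=; rewrite eqxx.
  have [p [q [Xp nXq epq]]] := connect_leave (ce x c) Xx nXc.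
  exists p; split=> //; have [qc|qc] := eqVneq q c.
    by constructor 1; rewrite se -qc.
  by constructor 3; exists q.
- move=> x y p q /and3P[Sx Sy exy] /and3P[Sp Sq epq] n _.
  have := pt x y p q exy epq n.
  by case: (t x p) (t x q) (t y p) (t y q) (t x c) (t y c) (t p c) (t q c)
    => [] [] [] [] [] [] [] [].
- move=> x p q ecx /and3P[Sp Sq epq] xp xq _.
  have := pt c x p q ecx epq; rewrite (eq_sym c) (eq_sym c) xp xq.
  rewrite [p != c]Sp [q != c]Sq => /(_ isT).
  rewrite (tt c p) 1?eq_sym // (tt c q) 1?eq_sym //.
  by case: (t x p) (t x q) (t p c) (t q c) (t x c) => [] [] [] [] [].
Qed.

(** * Placing the vertices *)

Local Open Scope ring_scope.

(** As the radius of [w] will be the distance to its farthest neighbour, this makes the interval of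
    [w] miss [q]. *)
Definition closer (R : realType) (V : finType) (e : rel V) (S A B : pred V)
    (a b : R) (p : V -> R) (w : V) (q : R) : Prop :=
  [/\ forall y, S y -> e w y -> `|p w - p y| < `|p w - q|,
      A w -> `|p w - a| < `|p w - q| & B w -> `|p w - b| < `|p w - q| ].

(** [placed_out] covers the positions of all nonneighbours outside [S], including an end not
    adjacent to [w]. The bounds [3 / 5] keep the neighbours of an end near it, so that its own
    radius stays small; this is used when that end is the middle vertex of a larger gap. *)
Record placed (R : realType) (V : finType) (e : rel V) (S A B : pred V)
    (a b : R) (p : V -> R) : Prop := Placed {
  placed_in : forall w, S w -> a < p w < b;
  placed_out : forall w q, S w ->
    [\/ q < a, b < q, q = a /\ ~~ A w | q = b /\ ~~ B w] ->
    closer e S A B a b p w q;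
  placed_nonadj : forall w w', S w -> S w' -> w != w' -> ~~ e w w' ->
    closer e S A B a b p w (p w') \/ closer e S A B a b p w' (p w);
  placed_left : forall w, S w -> A w -> p w - a <= 3 / 5 * (b - a);
  placed_right : forall w, S w -> B w -> b - p w <= 3 / 5 * (b - a) }.

(* [w] is put in the middle of the gap, but slightly nearer to its neighbour when
   it is adjacent to only one of the ends, so that its radius stays smaller than
   its distance to every nonneighbour placed before it. *)
Lemma placed_split (R : realType) (V : finType) (e : rel V) (S A B : pred V)
    w S1 S2 (a b : R) :
  simple_graph e -> (forall x, A x -> S x) -> (forall x, B x -> S x) ->
  gap_split e S A B w S1 S2 -> a < b ->
  (forall a b : R, a < b -> exists p, placed e S1 [pred x | S1 x && A x]
    [pred x | S1 x && e w x] a b p) ->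
  (forall a b : R, a < b -> exists p, placed e S2 [pred x | S2 x && e w x]
    [pred x | S2 x && B x] a b p) ->
  exists p, placed e S A B a b p.
Proof.
move=> [se ie] AS BS [Sm n1 n2 d ne l r] ab P1 P2.
have Sw : S w by rewrite Sm eqxx.
(* In units of [b - a]: with [2 / 5], the neighbours of [w] in [S2] are at distance at most
   [3 / 5 * (3 / 5) < 2 / 5], hence nearer than [a]. The value [3 / 5] is the mirror image. *)
pose th : R := if A w == B w then 1 / 2 else if A w then 2 / 5 else 3 / 5.
pose m := a + th * (b - a).
have am : a < m.
  by rewrite /m /th; case: (A w) (B w) => [] [] /=; lra.
have mb : m < b.
  by rewrite /m /th; case: (A w) (B w) => [] [] /=; lra.
have [p1 [in1 out1 non1 lf1 rt1]] := P1 _ _ am.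
have [p2 [in2 out2 non2 lf2 rt2]] := P2 _ _ mb.
pose p x := if x == w then m else if S1 x then p1 x else p2 x.
have pw : p w = m by rewrite /p eqxx.
have pS1 x : S1 x -> p x = p1 x.
  by move=> S1x; rewrite /p S1x; case: eqP => // xw; move: n1; rewrite -xw S1x.
have pS2 x : S2 x -> p x = p2 x.
  move=> S2x; rewrite /p; case: eqP => [xw|_]; first by move: n2; rewrite -xw S2x.
  by case: ifP => // /d; rewrite S2x.
have nw1 x : S1 x -> x != w by move=> S1x; apply: contraNneq n1 => <-.
have nw2 x : S2 x -> x != w by move=> S1x; apply: contraNneq n2 => <-.
have Sor x : S x -> [\/ x = w, S1 x | S2 x].
  by rewrite Sm => /or3P[/eqP|?|?]; [constructor 1|constructor 2|constructor 3].
have cl1 x q : S1 x ->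
    closer e S1 [pred x | S1 x && A x] [pred x | S1 x && e w x] a m p1 x q ->
    closer e S A B a b p x q.
  move=> S1x [c1 c2 c3]; split; rewrite (pS1 x) //.
  - move=> y Sy exy; case: (Sor _ Sy) => [yw|S1y|S2y].
    + by rewrite yw pw; apply: c3; rewrite /= S1x se -yw.
    + by rewrite pS1 //; apply: c1.
    + by have := ne _ _ S1x S2y; rewrite exy.
  - by move=> Ax; apply: c2; rewrite /= S1x.
  - by move=> Bx; have := r x Bx (nw1 _ S1x); move/negPf: (d _ S1x) => ->.
have cl2 x q : S2 x ->
    closer e S2 [pred x | S2 x && e w x] [pred x | S2 x && B x] m b p2 x q ->
    closer e S A B a b p x q.
  move=> S2x [c1 c2 c3]; split; rewrite (pS2 x) //.
  - move=> y Sy exy; case: (Sor _ Sy) => [yw|S1y|S2y].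
    + by rewrite yw pw; apply: c2; rewrite /= S2x se -yw.
    + by have := ne _ _ S1y S2x; rewrite se exy.
    + by rewrite pS2 //; apply: c1.
  - by move=> Ax; have := d _ (l x Ax (nw2 _ S2x)); rewrite S2x.
  - by move=> Bx; apply: c3; rewrite /= S2x.
have clw q : [\/ q < a, b < q, q = a /\ ~~ A w | q = b /\ ~~ B w] ->
    closer e S A B a b p w q.
  move=> qP.
  have q1 : m - q <= `|m - q| by apply: ler_norm.
  have q2 : q - m <= `|m - q| by rewrite distrC; apply: ler_norm.
  split; rewrite pw.
  - move=> y Sy ewy; case: (Sor _ Sy) => [yw|S1y|S2y].
    + by rewrite yw ie in ewy.
    + have /andP[ay ym] := in1 _ S1y.
      have := rt1 y S1y; rewrite /= S1y ewy => /(_ isT) ny.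
      rewrite pS1 // gtr0_norm ?subr_gt0 //.
      case: qP => [qa|bq|[qa nA]|[qb nB]]; move: q1 q2 ny am mb; rewrite /m /th;
        rewrite ?(negPf nA) ?(negPf nB);
        by case: (A w) (B w) => [] [] /=; lra.
    + have /andP[my yb] := in2 _ S2y.
      have := lf2 y S2y; rewrite /= S2y ewy => /(_ isT) ny.
      rewrite pS2 // distrC gtr0_norm ?subr_gt0 //.
      case: qP => [qa|bq|[qa nA]|[qb nB]]; move: q1 q2 ny am mb; rewrite /m /th;
        rewrite ?(negPf nA) ?(negPf nB);
        by case: (A w) (B w) => [] [] /=; lra.
  - move=> Aw; rewrite (@gtr0_norm _ (m - a)) ?subr_gt0 //.
    case: qP => [qa|bq|[qa nA]|[qb nB]]; move: q1 q2 am mb; rewrite /m /th Aw;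
      rewrite ?(negPf nB);
      by [case: (B w) => /=; lra | rewrite Aw in nA].
  - move=> Bw; rewrite (distrC m b) (@gtr0_norm _ (b - m)) ?subr_gt0 //.
    case: qP => [qa|bq|[qa nA]|[qb nB]]; move: q1 q2 am mb; rewrite /m /th Bw;
      rewrite ?(negPf nA);
      by [case: (A w) => /=; lra | rewrite Bw in nB].
have in1' x : S1 x -> a < p x < m by move=> S1x; rewrite pS1 // in1.
have in2' x : S2 x -> m < p x < b by move=> S2x; rewrite pS2 // in2.
have w1 x : S1 x -> ~~ e w x -> closer e S A B a b p x m.
  move=> S1x nwx; apply: cl1 => //; apply: out1 => //; constructor 4.
  by rewrite /= S1x.
have w2 x : S2 x -> ~~ e w x -> closer e S A B a b p x m.
  move=> S2x nwx; apply: cl2 => //; apply: out2 => //; constructor 3.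
  by rewrite /= S2x.
exists p; split.
- move=> x /Sor[->|S1x|S2x]; first by rewrite pw am.
    by have /andP[-> /lt_trans->] := in1' _ S1x.
  by have /andP[/(lt_trans am) -> ->] := in2' _ S2x.
- move=> x q /Sor[->|S1x|S2x] qP; first exact: clw.
    apply: cl1 => //; apply: out1 => //.
    case: qP => [qa|bq|[qa nA]|[qb nB]]; [constructor 1|constructor 2
      |constructor 3|constructor 2] => //; rewrite /= ?negb_and ?nA ?orbT //.
      exact: lt_trans bq.
    by rewrite qb.
  apply: cl2 => //; apply: out2 => //.
  case: qP => [qa|bq|[qa nA]|[qb nB]]; [constructor 1|constructor 2
    |constructor 1|constructor 4] => //; rewrite /= ?negb_and ?nB ?orbT //.
    exact: lt_trans am.
  by rewrite qa.
(* A vertex of [S1] has no neighbour beyond [w], so [placed_out] in the left gap applies to every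
   position beyond [m]. *)
- have cross x x' : S1 x -> S2 x' ->
      closer e S A B a b p x (p x').
    move=> S1x S2x'; apply: cl1 => //; apply: out1 => //; constructor 2.
    by case/andP: (in2' _ S2x').
  move=> x x' /Sor[->|S1x|S2x] /Sor[->|S1x'|S2x'] xx' nxx'.
  + by rewrite eqxx in xx'.
  + by right; rewrite pw; apply: w1.
  + by right; rewrite pw; apply: w2.
  + by left; rewrite pw; apply: w1; rewrite // se.
  + by case: (non1 x x' S1x S1x' xx' nxx') => H; [left|right];
      apply: cl1 => //; rewrite pS1.
  + by left; apply: cross.
  + by left; rewrite pw; apply: w2; rewrite // se.
  + by right; apply: cross.
  + by case: (non2 x x' S2x S2x' xx' nxx') => H; [left|right];
      apply: cl2 => //; rewrite pS2.
- move=> x _ Ax; have [->|xw] := eqVneq x w.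
    by rewrite pw /m /th; case: (A w) (B w) => [] [] /=; lra.
  have S1x := l _ Ax xw; rewrite pS1 //.
  have := lf1 x S1x; rewrite /= S1x Ax => /(_ isT); lra.
- move=> x _ Bx; have [->|xw] := eqVneq x w.
    by rewrite pw /m /th; case: (A w) (B w) => [] [] /=; lra.
  have S2x := r _ Bx xw; rewrite pS2 //.
  have := rt2 x S2x; rewrite /= S2x Bx => /(_ isT); lra.
Qed.

Lemma gap_placed (R : realType) (V : finType) (e t : rel V) (S A B : pred V)
    (a b : R) :
  simple_graph e -> tournament t -> gap e t S A B -> a < b ->
  exists p, placed e S A B a b p.
Proof.
move=> ge tt; have [n] := ubnP #|S|.
elim: n S A B a b => // n IH S A B a b Sn G ab.
have [S0|nS0] := pselect (exists x, S x); last first.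
  have nS x : S x -> False by move=> Sx; apply: nS0; exists x.
  by exists (fun=> 0); split=> w; first [by move/nS | by move=> ? /nS].
have [w [S1 [S2 [sp G1 G2]]]] := gap_splitting (adj_sym ge) tt G S0.
have small (S' : pred V) : (forall x, S' x -> S x) -> ~~ S' w -> (#|S'| < n)%N.
  move=> S'S nS'w; apply: leq_trans (_ : #|S| <= n)%N => //.
  apply: proper_card; apply/properP; split; first exact/fintype.subsetP.
  by exists w; rewrite unfold_in // (split_mem sp) eqxx.
apply: (placed_split ge (gap_left G) (gap_right G) sp ab) => a' b' ab'.
  apply: IH G1 ab'; apply: small (split_left_nw sp).
  by move=> x S1x; rewrite (split_mem sp) S1x orbT.
apply: IH G2 ab'; apply: small (split_right_nw sp).
by move=> x S2x; rewrite (split_mem sp) S2x !orbT.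
Qed.

(** With the farthest neighbour as radius, edges are realized at once, and for a nonadjacent pair it
    suffices that one interval misses the other midpoint. *)
Lemma cAnd1_of_positions (R : realType) (V : finType) (e : rel V) (p : V -> R) :
  simple_graph e -> connected_graph e ->
  (forall u v, u != v -> ~~ e u v ->
    (forall y, e u y -> `|p u - p y| < `|p u - p v|) \/
    (forall y, e v y -> `|p v - p y| < `|p u - p v|)) ->
  cAnd1 R e.
Proof.
move=> [se ie] ce pP.
pose r v : R := \big[Num.max/0]_(y | e v y) `|p v - p y|.
have r0 v : 0 <= r v.
  by rewrite /r; elim/big_rec: _ => // i x _ x0; rewrite le_max x0 orbT.
have rle v y : e v y -> `|p v - p y| <= r v.
  by move=> evy; rewrite /r (bigD1 y) //= le_max lexx.
(* Connectedness gives [u] a neighbour, so [x] exceeds 0, the starting value of the maximum. *)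
have rlt u v (x : R) : u != v ->
    (forall y, e u y -> `|p u - p y| < x) -> r u < x.
  move=> uv H; have [|y [z [/eqP -> _ euz]]] :=
    @connect_leave _ _ (pred1 u) _ _ (ce u v) (eqxx u).
    by rewrite /= eq_sym.
  have x0 : 0 < x by apply: le_lt_trans (H z euz).
  rewrite /r; elim/big_ind: _ => // y' z' yx zx.
  by rewrite gt_max yx.
exists (fun v => p v - r v), (fun v => p v + r v); split.
  by move=> v; have := r0 v; lra.
have mid v : midpoint (p v - r v) (p v + r v) = p v by rewrite /midpoint; lra.
have dist u v : (p u \in `[p v - r v, p v + r v]) = (`|p u - p v| <= r v).
  by rewrite in_itv /= ler_distl.
move=> u v /eqP uv; rewrite !mid !dist; split.
  by move=> euv; rewrite distrC rle // distrC rle // se.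
case=> vu uv'; apply/negPn/negP => nuv.
case: (pP _ _ uv nuv) => H.
  by have := rlt _ _ _ uv H; rewrite distrC ltNge vu.
have vNu : v != u by rewrite eq_sym.
by have := rlt _ _ _ vNu H; rewrite ltNge uv'.
Qed.

(** The root goes to 0 and all other vertices strictly between 0 and 1; the right end 1 carries no
    vertex. *)
Lemma parity_drawn_cAnd1 (R : realType) (V : finType) (e t : rel V) :
  simple_graph e -> connected_graph e -> tournament t -> parity_drawn e t ->
  cAnd1 R e.
Proof.
move=> ge ce tt pt; have [[c _]|V0] := pselect (exists c : V, True); last first.
  exists (fun=> 0), (fun=> 0).
  by split=> [v|v]; case: V0; exists v.
have [t' tt' G] := root_gap c ge ce tt pt.
have [p [pin pout pnon _ _]] := gap_placed ge tt' G (@ltr01 R).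
pose p' x := if x == c then 0 else p x.
have p'c : p' c = 0 by rewrite /p' eqxx.
have p'p x : x != c -> p' x = p x by rewrite /p'; move/negPf=> ->.
have se := adj_sym ge.
have full x q : x != c ->
    closer e (predC1 c) (e c) pred0 0 1 p x q ->
    forall y, e x y -> `|p' x - p' y| < `|p' x - q|.
  move=> xc [c1 c2 _] y exy; rewrite (p'p x) //.
  have [yc|yc] := eqVneq y c; last by rewrite p'p //; apply: c1.
  by rewrite yc p'c; apply: c2; rewrite se -yc.
have cnear x : x != c -> ~~ e c x ->
    forall y, e x y -> `|p' x - p' y| < `|p' x - p' c|.
  move=> xc ncx; apply: full => //; apply: pout => //; constructor 3.
  by rewrite p'c.
have key u v : u != v -> ~~ e u v ->
    (forall y, e u y -> `|p' u - p' y| < `|p' u - p' v|) \/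
    (forall y, e v y -> `|p' v - p' y| < `|p' u - p' v|).
  move=> uv nuv; have [uc|uc] := eqVneq u c.
    right; rewrite distrC uc; apply: cnear; first by rewrite -uc eq_sym.
    by rewrite -uc.
  have [vc|vc] := eqVneq v c.
    by left; rewrite vc; apply: cnear => //; rewrite -vc se.
  case: (pnon u v uc vc uv nuv) => H; [left|right].
    by rewrite (p'p v) //; apply: full.
  by rewrite distrC (p'p u) //; apply: full.
exact: (@cAnd1_of_positions R V e p').
Qed.

(** * Crossing parities of polygonal paths *)

(* The open half-plane above the first axis, perturbed by including half of the
   axis, so that it contains exactly one of [x] and [- x] for [x != 0]. *)
Definition lexpos (R : realType) (x : R * R) : bool :=
  (0 < x.2) || (x.2 == 0) && (0 < x.1).

Definition det2 (R : realType) (x y : R * R) : R := x.1 * y.2 - x.2 * y.1.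

(* The segment from [x] to [y], assumed not to contain 0, crosses the
   (perturbed) negative first half-axis. *)
Definition crosses (R : realType) (x y : R * R) : bool :=
  [&& lexpos x, ~~ lexpos y & 0 < det2 x y] ||
  [&& ~~ lexpos x, lexpos y & det2 x y < 0].

Definition segpt (R : realType) (t : R) (x y : R * R) : R * R :=
  ((1 - t) * x.1 + t * y.1, (1 - t) * x.2 + t * y.2).

Definition segs_disjoint (R : realType) (a b c d : R * R) : Prop :=
  forall s t : R, 0 <= s <= 1 -> 0 <= t <= 1 -> segpt s a b <> segpt t c d.

Lemma segpt0 (R : realType) (x y : R * R) : segpt 0 x y = x.
Proof. by rewrite /segpt subr0 !mul0r !mul1r !addr0 -surjective_pairing. Qed.

Lemma segpt1 (R : realType) (x y : R * R) : segpt 1 x y = y.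
Proof. by rewrite /segpt subrr !mul0r !mul1r !add0r -surjective_pairing. Qed.

Lemma lexposN (R : realType) (x : R * R) : x != 0 -> lexpos (- x) = ~~ lexpos x.
Proof.
case: x => x1 x2; rewrite /lexpos /= -pair_eqE /= oppr_gt0 oppr_eq0 oppr_gt0.
by case: (ltrgtP x2 0) => //=; case: (ltrgtP x1 0).
Qed.

Lemma det2C (R : realType) (x y : R * R) : det2 y x = - det2 x y.
Proof. by rewrite /det2; ring. Qed.

Lemma crossesC (R : realType) (x y : R * R) : crosses x y = crosses y x.
Proof.
rewrite /crosses (det2C x y) oppr_gt0 oppr_lt0.
by case: (lexpos x) (lexpos y) => [] [] //=; rewrite ?orbF.
Qed.

Lemma crosses_same (R : realType) (x y : R * R) :
  lexpos x = lexpos y -> crosses x y = false.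
Proof. by rewrite /crosses => ->; case: (lexpos y); rewrite /= ?andbF. Qed.

(* 0 is not in the convex hull of [x], [y], [z]. *)
Definition zero_free (R : realType) (x y z : R * R) : Prop :=
  forall k l m : R, 0 <= k -> 0 <= l -> 0 <= m -> 0 < k + l + m ->
  k * x.1 + l * y.1 + m * z.1 = 0 -> k * x.2 + l * y.2 + m * z.2 = 0 -> False.

(** By Cramer's rule [det2 y z * x - det2 x z * y + det2 x y * z = 0]. If [det2 x z <= 0], then
    either all coefficients are nonnegative and 0 is in the hull, or a positive multiple of [x] is a
    nonnegative combination of [y] and [z], which lie in the other half-plane. *)
Lemma zero_free_det2 (R : realType) (x y z : R * R) :
  zero_free x y z -> lexpos x -> ~~ lexpos y -> ~~ lexpos z ->
  0 < det2 x y -> 0 < det2 x z.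
Proof.
move=> zf hx hy hz xy; rewrite ltNge; apply/negP => xz.
have := zf (det2 y z) (- det2 x z) (det2 x y).
have e1 : det2 y z * x.1 + - det2 x z * y.1 + det2 x y * z.1 = 0.
  by rewrite /det2; ring.
have e2 : det2 y z * x.2 + - det2 x z * y.2 + det2 x y * z.2 = 0.
  by rewrite /det2; ring.
case: (leP 0 (det2 y z)) => yz; first by move=> zf'; apply: zf' => //; lra.
move=> _; move: xy xz yz e1 e2.
move: (det2 x y) (det2 x z) (det2 y z) => A B C A0 B0 C0 e1 e2.
have nonpos (v : R * R) : ~~ lexpos v -> v.2 < 0 \/ v.2 = 0 /\ v.1 <= 0.
  rewrite /lexpos; case: (ltrgtP v.2 0) => //= v2; first by left.
  by rewrite -leNgt; right.
move: (nonpos _ hy) (nonpos _ hz) hx; rewrite /lexpos.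
move: x.1 x.2 y.1 y.2 z.1 z.2 e1 e2 {hy hz nonpos zf}.
move=> x1 x2 y1 y2 z1 z2 e1 e2 hy hz hx.
have y2' : y2 <= 0 by case: hy; lra.
have z2' : z2 <= 0 by case: hz; lra.
have p1 : 0 <= B * y2 by nra.
have p2 : A * z2 <= 0 by nra.
case/orP: hx => [x2p|/andP[/eqP x20 x1p]]; first by nra.
have z20 : z2 = 0 by nra.
have z1' : z1 <= 0 by case: hz; lra.
have q2 : A * z1 <= 0 by nra.
have q3 : C * x1 < 0 by nra.
case: hy => [y2n|[_ y1']].
  have : B = 0 by nra.
  by move=> BE; rewrite BE in e1; lra.
have : 0 <= B * y1 by nra.
lra.
Qed.

Lemma zero_free_det2_neq0_pos (R : realType) (x y z : R * R) :
  zero_free x y z -> lexpos x -> ~~ lexpos y -> det2 x y != 0.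
Proof.
move=> zf; rewrite /lexpos /det2 => hx hy; apply/eqP => d0.
case/orP: hx => [x2|/andP[/eqP x2 x1]].
  by apply: (zf (- y.2) x.2 0); move: hy; case: (ltrgtP y.2 0) => //= *; lra.
have y2 : y.2 = 0.
  by apply: (mulfI (lt0r_neq0 x1)); rewrite mulr0 -d0 x2; ring.
move: hy; rewrite y2 ltxx eqxx /= -leNgt => y1.
by apply: (zf (- y.1) x.1 0); rewrite ?x2 ?y2 //; lra.
Qed.

Lemma zero_freeC (R : realType) (x y z : R * R) :
  zero_free x y z -> zero_free x z y.
Proof. by move=> zf k l m k0 l0 m0 s e1 e2; apply: (zf k m l); lra. Qed.

Lemma zero_freeR (R : realType) (x y z : R * R) :
  zero_free x y z -> zero_free y z x.
Proof. by move=> zf k l m k0 l0 m0 s e1 e2; apply: (zf m k l); lra. Qed.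

Lemma zero_freeN (R : realType) (x y z : R * R) :
  zero_free x y z -> zero_free (- x) (- y) (- z).
Proof.
by move=> zf k l m k0 l0 m0 s /= e1 e2; apply: (zf k l m) => //; lra.
Qed.

Lemma zero_free_neq0 (R : realType) (x y z : R * R) :
  zero_free x y z -> x != 0.
Proof.
move=> zf; apply/eqP => x0; apply: (zf 1 0 0); rewrite ?x0 //=; lra.
Qed.

Lemma zero_free_det2_neq0 (R : realType) (x y z : R * R) :
  zero_free x y z -> lexpos y = ~~ lexpos x -> det2 x y != 0.
Proof.
move=> zf yE; have nx := zero_free_neq0 zf.
have ny := zero_free_neq0 (zero_freeR zf).
have [hx|hx] := boolP (lexpos x).
  by apply: (zero_free_det2_neq0_pos zf) => //; rewrite yE hx.
have := @zero_free_det2_neq0_pos R _ _ _ (zero_freeN zf).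
by rewrite !lexposN // yE hx /det2 /= !mulrNN => /(_ isT isT).
Qed.

Lemma crosses_apex (R : realType) (x y z : R * R) :
  zero_free x y z -> lexpos y = ~~ lexpos x -> lexpos z = ~~ lexpos x ->
  crosses x y = crosses x z.
Proof.
move=> zf yE zE; have xyn := zero_free_det2_neq0 zf yE.
have xzn := zero_free_det2_neq0 (zero_freeC zf) zE.
have nx := zero_free_neq0 zf; have ny := zero_free_neq0 (zero_freeR zf).
have nz := zero_free_neq0 (zero_freeR (zero_freeR zf)).
rewrite /crosses yE zE; case: (boolP (lexpos x)) yE zE => hx /= yE zE.
  rewrite !orbF; apply/idP/idP; apply: zero_free_det2; rewrite ?yE ?zE //.
  exact: zero_freeC.
rewrite !lt_neqAle xyn ?xzn //= !leNgt; congr negb.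
have detNN (u v : R * R) : det2 u v = det2 (- u) (- v).
  by rewrite /det2 /= !mulrNN.
have zfN := zero_freeN zf; rewrite (detNN x y) (detNN x z).
by apply/idP/idP; apply: zero_free_det2;
  rewrite ?lexposN ?hx ?yE ?zE //; apply: zero_freeC.
Qed.

(** Negation exchanges the two half-axes. A segment avoiding 0 crosses the axis exactly when its
    ends lie in different half-planes, and then it crosses just one half-axis. *)
Lemma crossesN (R : realType) (x y : R * R) :
  (forall t : R, 0 <= t <= 1 -> segpt t x y <> 0) ->
  crosses (- x) (- y) = crosses x y (+) (lexpos x (+) lexpos y).
Proof.
move=> xy0.
have x0 : x != 0.
  apply/eqP => x0; apply: (xy0 0); first by rewrite lexx ler01.
  by rewrite segpt0.
have y0 : y != 0.
  apply/eqP => y0; apply: (xy0 1); first by rewrite lexx ler01.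
  by rewrite segpt1.
have zf : zero_free x y y.
  move=> k l m k0 l0 m0 s e1 e2; have sn : k + l + m != 0 by apply: lt0r_neq0.
  apply: (xy0 ((l + m) / (k + l + m))).
    apply/andP; split; first by apply: divr_ge0; lra.
    by rewrite ler_pdivrMr //; lra.
  have E u v : (1 - (l + m) / (k + l + m)) * u + (l + m) / (k + l + m) * v =
      (k * u + l * v + m * v) / (k + l + m) by field.
  by rewrite /segpt !E e1 e2 !mul0r.
have D : det2 (- x) (- y) = det2 x y by rewrite /det2 /= !mulrNN.
have dn := zero_free_det2_neq0 zf.
rewrite /crosses D !lexposN //.
move: dn; case: (lexpos x) (lexpos y) => [] [] //= dn;
  by case: (ltrgtP (det2 x y) 0) dn => // _ /(_ erefl).
Qed.

Lemma addbE : addb =2 xorb.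
Proof. by do 2 case. Qed.

(** Adds a known relation modulo 2 to the goal; once all relations are added, a tautology
    remains. *)
Lemma addb_transfer (a b c d : bool) : c = d -> a (+) c = b (+) d -> a = b.
Proof. by move=> -> /addIb. Qed.

(** The parity of the winding number around 0. Two corners lie in the same half-plane, so the side
    joining them does not cross; the other two sides agree by [crosses_apex]. *)
Lemma crosses_triangle (R : realType) (x y z : R * R) :
  zero_free x y z -> crosses x y (+) crosses y z (+) crosses z x = false.
Proof.
have wl (u v w : R * R) : zero_free u v w -> lexpos v = lexpos w ->
    crosses u v (+) crosses v w (+) crosses w u = false.
  move=> zf vw; rewrite (crosses_same vw) addbF (crossesC w).
  have [uv|uv] := eqVneq (lexpos u) (lexpos v).
    by rewrite !crosses_same -?vw.
  have vE : lexpos v = ~~ lexpos u by case: (lexpos v) (lexpos u) uv => [] [].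
  by rewrite (crosses_apex zf vE) -?vw // addbb.
move=> zf; have zf1 := zero_freeR zf; have zf2 := zero_freeR zf1.
have [yz|yz] := eqVneq (lexpos y) (lexpos z); first exact: wl.
have [zx|zx] := eqVneq (lexpos z) (lexpos x).
  have := wl _ _ _ zf1 zx.
  by case: (crosses x y) (crosses y z) (crosses z x) => [] [] [].
have xy : lexpos x = lexpos y.
  by case: (lexpos x) (lexpos y) (lexpos z) yz zx => [] [] [].
have := wl _ _ _ zf2 xy.
by case: (crosses x y) (crosses y z) (crosses z x) => [] [] [].
Qed.

(** * Disjoint segments and polygonal paths *)

Lemma segpt_divE (R : realType) (u v : R) (x y : R * R) : 0 < u + v ->
  segpt (v / (u + v)) x y =
  ((u * x.1 + v * y.1) / (u + v), (u * x.2 + v * y.2) / (u + v)).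
Proof.
move=> /lt0r_neq0 s0.
by rewrite /segpt; congr pair; field.
Qed.

Lemma segs_disjoint_comb (R : realType) (a b c d : R * R) (k l m n : R) :
  segs_disjoint a b c d -> 0 <= k -> 0 <= l -> 0 <= m -> 0 <= n ->
  0 < k + l -> k + l = m + n ->
  k * a.1 + l * b.1 = m * c.1 + n * d.1 ->
  k * a.2 + l * b.2 = m * c.2 + n * d.2 -> False.
Proof.
move=> dj k0 l0 m0 n0 s0 sE e1 e2.
have i (u v : R) : 0 <= u -> 0 <= v -> 0 < u + v -> 0 <= v / (u + v) <= 1.
  move=> u0 v0 uv0; apply/andP; split; first by apply: divr_ge0; lra.
  by rewrite ler_pdivrMr //; lra.
have s0' : 0 < m + n by rewrite -sE.
apply: (dj (l / (k + l)) (n / (m + n))); rewrite ?i //.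
by rewrite !segpt_divE // e1 e2 sE.
Qed.

(** The differences of points of the two segments fill a parallelogram with these four corners. It
    avoids 0 because the segments are disjoint, and it is cut into two triangles. *)
Lemma crosses_square (R : realType) (a b c d : R * R) :
  segs_disjoint a b c d ->
  crosses (a - c) (b - c) (+) crosses (a - d) (b - d) (+)
  (crosses (b - c) (b - d) (+) crosses (a - c) (a - d)) = false.
Proof.
move=> dj.
have z1 : zero_free (a - c) (b - c) (b - d).
  move=> k l m k0 l0 m0 s0 /= e1 e2.
  by apply: (@segs_disjoint_comb _ a b c d k (l + m) (k + l) m dj); lra.
have z2 : zero_free (a - c) (b - d) (a - d).
  move=> k l m k0 l0 m0 s0 /= e1 e2.
  by apply: (@segs_disjoint_comb _ a b c d (k + m) l k (l + m) dj); lra.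
have := crosses_triangle z1; have := crosses_triangle z2.
rewrite (crossesC (b - d) (a - d)) (crossesC (a - d) (a - c)).
rewrite (crossesC (b - d) (a - c)).
by case: (crosses _ _) (crosses _ _) (crosses _ _) (crosses _ _) (crosses _ _)
  => [] [] [] [] [].
Qed.

Fixpoint polypath (T : Type) (r : T -> T -> Prop) (x : T) (s : seq T) : Prop :=
  if s is y :: s' then r x y /\ polypath r y s' else True.

(* Parity, seen from [c], of the polygonal path through [x] and then [s]. *)
Fixpoint crossings (R : realType) (c x : R * R) (s : seq (R * R)) : bool :=
  if s is y :: s' then crosses (x - c) (y - c) (+) crossings c y s' else false.

(** [crossesN] turns the two sides on which [a] or [b] is fixed into the segment [cd] seen from that
    point, at the cost of the [lexpos] terms. *)
Lemma crosses_square_lexpos (R : realType) (a b c d : R * R) :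
  segs_disjoint a b c d ->
  crosses (a - c) (b - c) (+) crosses (a - d) (b - d) =
  crosses (c - b) (d - b) (+) crosses (c - a) (d - a) (+)
    (lexpos (c - a) (+) lexpos (c - b) (+) (lexpos (d - a) (+) lexpos (d - b))).
Proof.
move=> dj; have := crosses_square dj.
have N x : x = a \/ x = b ->
    forall t : R, 0 <= t <= 1 -> segpt t (c - x) (d - x) <> 0.
  move=> xab t t01 [/= e1 e2].
  have [s s01 xE] : exists2 s : R, 0 <= s <= 1 & segpt s a b = x.
    by case: xab => ->; [exists 0 | exists 1];
      rewrite ?lexx ?ler01 ?segpt0 ?segpt1.
  apply: (dj s t) => //; rewrite xE /segpt [LHS]surjective_pairing.
  by congr pair; lra.
have := crossesN (N a _); have := crossesN (N b _); rewrite !opprB.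
move=> -> //; last by right.
move=> -> //; last by left.
by move=> H; apply: (addb_transfer H); rewrite !addbE; btauto.
Qed.

Lemma crossings_segment (R : realType) (a b c : R * R) (s : seq (R * R)) :
  polypath (segs_disjoint a b) c s ->
  crosses (a - c) (b - c) (+) crosses (a - last c s) (b - last c s) =
  crossings a c s (+) crossings b c s (+)
   (lexpos (c - a) (+) lexpos (c - b) (+)
    (lexpos (last c s - a) (+) lexpos (last c s - b))).
Proof.
elim: s c => [|d s IH] c /=; first by rewrite !addbb.
case=> /crosses_square_lexpos H1 /IH H2.
by apply: (addb_transfer H1); apply: (addb_transfer H2); rewrite !addbE; btauto.
Qed.

(** The relations for all pairs of segments are added up; terms at inner points of either path occur
    twice and cancel. *)
Lemma crossings_polypath (R : realType) (a c : R * R) (r s : seq (R * R)) :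
  polypath (fun x y => polypath (segs_disjoint x y) c s) a r ->
  (crossings c a r (+) lexpos (c - a)) (+)
  (crossings (last c s) a r (+) lexpos (last c s - a)) =
  (crossings a c s (+) lexpos (c - last a r)) (+)
  (crossings (last a r) c s (+) lexpos (last c s - last a r)).
Proof.
elim: r a => [|b r IH] a /=.
  by case: (crossings a c s) (lexpos _) (lexpos _) => [] [] [].
case=> /crossings_segment H1 /IH H2.
by apply: (addb_transfer H1); apply: (addb_transfer H2); rewrite !addbE; btauto.
Qed.

(** * Polygonal paths in the drawing *)

Local Open Scope classical_set_scope.
Local Open Scope ring_scope.

Lemma polypath_impl (T : Type) (r r' : T -> T -> Prop) x s :
  (forall a b, r a b -> r' a b) -> polypath r x s -> polypath r' x s.
Proof. by move=> rr'; elim: s x => //= y s IH x [/rr' ? /IH]. Qed.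

Lemma polypath_rcons (T : Type) (r : T -> T -> Prop) x s y :
  polypath r x s -> r (last x s) y -> polypath r x (rcons s y).
Proof. by elim: s x => [|z s IH] x //= [? /IH H] /H. Qed.

(** The points reachable from [x] form a set that is open and closed in [S]: [r a b] gives openness
    and [r b a] closedness. *)
Lemma connected_polypath (T : topologicalType) (S : set T) (r : T -> T -> Prop) x y :
  connected S -> S x -> S y ->
  (forall a, S a -> \forall b \near a, S b -> r a b /\ r b a) ->
  exists s, polypath r x s /\ last x s = y.
Proof.
move=> cS Sx Sy nr.
pose reach z := exists s, polypath r x s /\ last x s = z.
have step a b : reach a -> r a b -> reach b.
  case=> s [ps <-] rab; exists (rcons s b); split; last by rewrite last_rcons.
  exact: polypath_rcons.
suff SE : [set z | S z /\ reach z] = S by move: Sy; rewrite -SE => -[].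
apply: cS.
- by exists x; split=> //; exists [::].
- exists [set z | S z -> reach z]^°; first exact: open_interior.
  apply/seteqP; split=> z [Sz]; last by move=> /interior_subset /(_ Sz).
  move=> rz; split=> //; have := nr _ Sz; apply: filterS => b H Sb.
  by apply: (step z) => //; case: (H Sb).
- exists (~` [set z | S z -> ~ reach z]^°).
    by apply: open_closedC; exact: open_interior.
  apply/seteqP; split=> z [Sz].
    by move=> rz; split=> // /interior_subset /(_ Sz).
  move=> nz; split=> //; apply: contrapT => nrz; apply: nz.
  have := nr _ Sz; apply: filterS => b H Sb rb; apply: nrz.
  by apply: step rb _; case: (H Sb).
Qed.

(** Stated for all small [e], so that finitely many separations can share one distance. *)
Lemma compact_closed_separated (R : realType) (T : pseudoMetricType R)
    (K L : set T) : compact K -> closed L -> (forall x, K x -> ~ L x) ->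
  \forall e \near (0 : R)^'+, forall x y, K x -> L y -> ~ ball x e y.
Proof.
move=> cK cL KL.
move/compact_near_coveringP: cK.
move=> /(_ R 0^'+ (fun e x => forall y, L y -> ~ ball x e y) _) cK.
suff : \forall e \near 0^'+, K `<=` (fun x => forall y, L y -> ~ ball x e y).
  by apply: filterS => e H x y Kx Ly; apply: H.
apply: cK => x Kx.
have /nbhs_ballP[d /= d0 dL] : nbhs x (~` L).
  by apply: open_nbhs_nbhs; split; [exact: closed_openC | exact: KL].
near=> x' e => y Ly x'ey; apply: (dL y) => //.
have ed : e <= d / 2 by near: e; apply: nbhs_right_le; rewrite divr_gt0.
rewrite (splitr d); apply: (ball_triangle (y := x')).
  by near: x'; apply: nbhsx_ballx; rewrite divr_gt0.
exact: le_ball x'ey.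
Unshelve. all: end_near. Qed.

Lemma conv_lt (R : realType) (u v m t : R) : 0 <= t <= 1 -> u < m -> v < m ->
  (1 - t) * u + t * v < m.
Proof.
move=> /andP[t0 t1] um vm; have [->|tn0] := eqVneq t 0; first by lra.
have tp : 0 < t by rewrite lt_neqAle eq_sym tn0.
have p1 : 0 < t * (m - v) by rewrite mulr_gt0 // subr_gt0.
have p2 : 0 <= (1 - t) * (m - u) by rewrite mulr_ge0 //; lra.
lra.
Qed.

Lemma conv_gt (R : realType) (u v m t : R) : 0 <= t <= 1 -> m < u -> m < v ->
  m < (1 - t) * u + t * v.
Proof.
move=> t01 um vm; have := @conv_lt R (- u) (- v) (- m) t t01; lra.
Qed.

Lemma ball_segpt (R : realType) (c x y : R * R) (e t : R) : 0 <= t <= 1 ->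
  ball c e x -> ball c e y -> ball c e (segpt t x y).
Proof.
move=> t01 [a1 a2] [b1 b2].
have key (c' x' y' : R) : ball c' e x' -> ball c' e y' ->
    ball c' e ((1 - t) * x' + t * y').
  rewrite /ball /= !ltr_norml => /andP[h1 h2] /andP[h3 h4].
  have g1 : (1 - t) * x' + t * y' < c' + e by apply: conv_lt => //; lra.
  have g2 : c' - e < (1 - t) * x' + t * y' by apply: conv_gt => //; lra.
  by apply/andP; split; lra.
by split; apply: key.
Qed.

Definition segset (R : realType) (x y : R * R) : set (R * R) :=
  [set segpt t x y | t in `[0, 1]].

Lemma segset_compact (R : realType) (x y : R * R) : compact (segset x y).
Proof.
apply: continuous_compact; last exact: segment_compact.
have c (u v : R) : continuous (fun t : R => (1 - t) * u + t * v).
  move=> t; apply: cvgD; apply: cvgM; [|exact: cvg_cst|exact: cvg_id|exact: cvg_cst].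
  by apply: cvgB; [exact: cvg_cst|exact: cvg_id].
apply: continuous_subspaceT => t.
exact: (cvg_pair (c x.1 y.1 t) (c x.2 y.2 t)).
Qed.

Lemma plane_compact_closed (R : realType) (K : set (R * R)) :
  compact K -> closed K.
Proof.
apply: compact_closed; exact: norm_hausdorff.
Qed.

Lemma arc_compact (R : realType) (V : finType) (e : rel V) pos
    (arc : V -> V -> R -> R * R) u v :
  plane_drawing e pos arc -> e u v -> compact (arc u v @` `[0, 1]).
Proof.
move=> pd euv; apply: continuous_compact; last exact: segment_compact.
exact: (arc_continuous pd euv).
Qed.

Lemma arc_connected (R : realType) (V : finType) (e : rel V) pos
    (arc : V -> V -> R -> R * R) u v :
  plane_drawing e pos arc -> e u v -> connected (arc u v @` `[0, 1]).
Proof.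
move=> pd euv; apply: connected_continuous_connected; first exact: segment_connected.
exact: (arc_continuous pd euv).
Qed.

Lemma drawing_set_compact (R : realType) (V : finType) (e : rel V) pos
    (arc : V -> V -> R -> R * R) :
  plane_drawing e pos arc -> compact (drawing_set e pos arc).
Proof.
move=> pd.
have -> : drawing_set e pos arc =
    (\big[setU/set0]_(v <- enum V) [set pos v]) `|`
    (\big[setU/set0]_(p <- enum {: V * V} | e p.1 p.2) (arc p.1 p.2 @` `[0, 1])).
  rewrite -bigcup_seq -bigcup_seq_cond; apply/seteqP; split=> x /=.
    case=> [[v ->]|[u [v [euv xuv]]]]; [left; exists v => //=|right; exists (u, v) => //=];
      by rewrite mem_enum.
  by case=> [[v _ ->]|[[u v] /= /andP[_ euv] xuv]]; [left; exists v|right; exists u, v].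
apply: compactU.
  by apply: bigsetU_compact => v _; exact: compact_set1.
by apply: bigsetU_compact => p ep; exact: arc_compact pd ep.
Qed.

(** The component of [x] is open and connected, hence connected by polygonal paths, and unbounded,
    hence it leaves a square containing [D]. Outside the square every point can be joined to the
    same [P]. *)
Lemma outer_face_polypath (R : realType) (D : set (R * R)) : compact D ->
  exists P, forall x, outer_face D x -> exists s,
    polypath (fun a b => segset a b `<=` ~` D) x s /\ last x s = P.
Proof.
move=> cD; have oD : open (~` D) by apply: closed_openC; exact: plane_compact_closed.
have [M M0 DM] := pinfty_ex_gt0 (compact_bounded cD).
have {}DM x : D x -> [/\ x.1 <= M, - M <= x.1, x.2 <= M & - M <= x.2].
  move=> /DM /=; rewrite /Num.norm /= ge_max !ler_norml => /andP[/andP[? ?] /andP[? ?]].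
  by [].
(* Outside the square of radius [M] one goes around it within half-planes. *)
pose K := M + 1; exists (K, K) => x ox.
have Dx : (~` D) x.
  apply: contrapT => nDx; apply: ox; rewrite /= connected_component_out //.
  by exists 0; split=> // N _ z.
have [y [Cy yM]] : exists y, connected_component (~` D) x y /\ M < `|y|.
  apply: contrapT => nex; apply: ox; exists M; split; first exact: num_real.
  move=> N MN y Cy; rewrite /= leNgt; apply/negP => Ny; apply: nex; exists y.
  by split=> //; apply: lt_trans Ny.
have [s [xs sy]] : exists s,
    polypath (fun a b => segset a b `<=` ~` D) x s /\ last x s = y.
  apply: (@connected_polypath _ (connected_component (~` D) x)) => //.
  - exact: component_connected.
  - exact: connected_component_refl.
  move=> a /connected_component_sub Da.
  have /nbhs_ballP[d /= d0 dD] := open_nbhs_nbhs (conj oD Da).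
  apply/nbhs_ballP; exists d => // b ab _.
  split=> z [t /= t01 <-]; apply: dD; apply: ball_segpt => //;
    by apply: ballxx.
suff [s' [ys' s'P]] : exists s',
    polypath (fun a b => segset a b `<=` ~` D) y s' /\ last y s' = (K, K).
  exists (s ++ s'); split; last by rewrite last_cat sy.
  elim: s x xs sy {ox Dx Cy} => [|z s IH] x /= => [_ ->//|[? zs] sy].
  by split=> //; exact: IH.
have KM : M < K by rewrite /K ltrDl.
have r1 a b : M < a.1 -> M < b.1 -> segset a b `<=` ~` D.
  move=> aM bM z [t /= t01 <-] /DM[+ _ _ _]; rewrite leNgt => /negP; apply.
  exact: conv_gt.
have r2 a b : M < a.2 -> M < b.2 -> segset a b `<=` ~` D.
  move=> aM bM z [t /= t01 <-] /DM[_ _ + _]; rewrite leNgt => /negP; apply.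
  exact: conv_gt.
have r3 a b : a.1 < - M -> b.1 < - M -> segset a b `<=` ~` D.
  move=> aM bM z [t /= t01 <-] /DM[_ + _ _]; rewrite leNgt => /negP; apply.
  exact: conv_lt.
have r4 a b : a.2 < - M -> b.2 < - M -> segset a b `<=` ~` D.
  move=> aM bM z [t /= t01 <-] /DM[_ _ _ +]; rewrite leNgt => /negP; apply.
  exact: conv_lt.
move: yM; rewrite /Num.norm /= lt_max !ltr_normr => /orP[] /orP[] yM.
- by exists [:: (K, K)]; split=> //; split=> //; exact: r1.
- exists [:: (- K, K); (K, K)]; split=> //; split; last by split=> //; exact: r2.
  by apply: r3; rewrite /= ?ltrN2 // ltrNr.
- by exists [:: (K, K)]; split=> //; split=> //; exact: r2.
- exists [:: (K, - K); (K, K)]; split=> //; split; last by split=> //; exact: r1.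
  by apply: r4; rewrite /= ?ltrN2 // ltrNr.
Qed.

(** * Paths and edges that do not meet *)

Lemma itv01_cases (R : realType) (t : R) :
  t \in `[0, 1] -> [\/ t = 0, t = 1 | t \in `]0, 1[].
Proof.
rewrite !in_itv /= => /andP[t0 t1].
have [->|tn0] := eqVneq t 0; first by constructor 1.
have [->|tn1] := eqVneq t 1; first by constructor 2.
by constructor 3; rewrite !lt_neqAle t0 t1 eq_sym tn0 tn1.
Qed.

Lemma vertex_notin_arc (R : realType) (V : finType) (e : rel V) pos
    (arc : V -> V -> R -> R * R) u w x :
  plane_drawing e pos arc -> e w x -> u != w -> u != x ->
  ~ (arc w x @` `[0, 1]) (pos u).
Proof.
move=> pd ewx uw ux [t /itv01_cases[->|->|t01]].
- by rewrite (arc_source pd ewx) => /(pos_inj pd)/eqP; rewrite eq_sym (negPf uw).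
- by rewrite (arc_target pd ewx) => /(pos_inj pd)/eqP; rewrite eq_sym (negPf ux).
- exact: (arc_avoids_vertices pd ewx t01).
Qed.

Lemma arcs_disjoint (R : realType) (V : finType) (e : rel V) pos
    (arc : V -> V -> R -> R * R) u v w x z :
  plane_drawing e pos arc -> e u v -> e w x ->
  [&& u != w, u != x, v != w & v != x] ->
  (arc u v @` `[0, 1]) z -> ~ (arc w x @` `[0, 1]) z.
Proof.
move=> pd euv ewx /and4P[uw ux vw vx] [t t01 <-] az.
have wxn (y : V) : y != w -> y != x -> arc u v t <> pos y.
  by move=> yw yx zy; apply: (vertex_notin_arc pd ewx yw yx); rewrite -zy.
case: (itv01_cases t01) => [t0|t1|t01'].
- by apply: (wxn u uw ux); rewrite t0 (arc_source pd euv).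
- by apply: (wxn v vw vx); rewrite t1 (arc_target pd euv).
case: az => t' /itv01_cases[->|->|t01''].
- by rewrite (arc_source pd ewx) => /esym; apply: (arc_avoids_vertices pd euv t01').
- by rewrite (arc_target pd ewx) => /esym; apply: (arc_avoids_vertices pd euv t01').
move=> /esym; apply: (arc_noncrossing pd euv ewx _ _ t01' t01'').
- by case=> wu _; rewrite wu eqxx in uw.
- by case=> wv _; rewrite wv eqxx in vw.
Qed.

Lemma near_finite_imp (T : Type) (I : finType) (F : set_system T) (b : pred I)
    (Q : I -> T -> Prop) {FF : Filter F} :
  (forall i, b i -> \forall x \near F, Q i x) ->
  \forall x \near F, forall i, b i -> Q i x.
Proof.
move=> H; apply: (@filter_forall _ _ (fun i x => b i -> Q i x)) => i.
case: (boolP (b i)) => bi; last by apply: filterE.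
by have := H i bi; apply: filterS.
Qed.

(** A small ball around [pos u] misses the arcs of all edges not incident to [u]. The path first
    moves inside it to a point of the outer face and then stays in that face. *)
Lemma outer_paths (R : realType) (V : finType) (e : rel V) pos
    (arc : V -> V -> R -> R * R) :
  plane_drawing e pos arc ->
  (forall v, closure (outer_face (drawing_set e pos arc)) (pos v)) ->
  exists P (g : V -> seq (R * R)), forall u, last (pos u) (g u) = P /\
    polypath (fun a b => forall w x, e w x -> u != w -> u != x ->
      forall z, segset a b z -> ~ (arc w x @` `[0, 1]) z) (pos u) (g u).
Proof.
move=> pd out; have cD := drawing_set_compact pd.
have [P PP] := outer_face_polypath cD; exists P.
suff H u : exists s, last (pos u) s = P /\
    polypath (fun a b => forall w x, e w x -> u != w -> u != x ->
      forall z, segset a b z -> ~ (arc w x @` `[0, 1]) z) (pos u) s.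
  by have [g gP] := choice H; exists g.
have : \forall z \near pos u, forall w x, e w x -> u != w -> u != x ->
    ~ (arc w x @` `[0, 1]) z.
  have : \forall z \near pos u, forall p : V * V,
      [&& e p.1 p.2, u != p.1 & u != p.2] -> (~` (arc p.1 p.2 @` `[0, 1])) z.
    apply: (@near_finite_imp _ (V * V)%type (nbhs (pos u))
      [pred p | [&& e p.1 p.2, u != p.1 & u != p.2]]
      (fun p => ~` (arc p.1 p.2 @` `[0, 1]))) => -[w x] /= /and3P[ewx uw ux].
    apply: open_nbhs_nbhs; split; last exact: vertex_notin_arc pd ewx uw ux.
    by apply: closed_openC; apply: plane_compact_closed; exact: arc_compact pd ewx.
  apply: filterS => z H w x ewx uw ux; apply: (H (w, x)).
  by rewrite ewx uw ux.
case/nbhs_ballP=> d /= d0 dP.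
have [q [oq uq]] := out u _ (nbhsx_ballx (pos u) d d0).
have [s [qs sP]] := PP q oq.
exists (q :: s); split=> //; split.
  move=> w x ewx uw ux z [t t01 <-]; apply: dP => //.
  by apply: ball_segpt => //; exact: ballxx.
apply: polypath_impl qs => a b ab w x ewx _ _ z /ab nDz az; apply: nDz.
by right; exists w, x.
Qed.

Lemma near_polypath (T I : Type) (F : set_system I) (FF : Filter F)
    (r : I -> T -> T -> Prop) x s :
  polypath (fun a b => \forall i \near F, r i a b) x s ->
  \forall i \near F, polypath (r i) x s.
Proof.
elim: s x => [|y s IH] x /=; first by move=> _; apply: filterE.
by case=> rxy /IH ys; apply: filterI.
Qed.

(** The corners need not follow the order of the arc: only the closeness of the path to the arc
    matters later. *)
Lemma edge_polypath (R : realType) (V : finType) (e : rel V) pos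
    (arc : V -> V -> R -> R * R) (eps : R) :
  plane_drawing e pos arc -> 0 < eps ->
  exists E : V -> V -> seq (R * R), forall u v, e u v ->
    last (pos u) (E u v) = pos v /\
    polypath (fun a b => (arc u v @` `[0, 1]) a /\ ball a eps b)
      (pos u) (E u v).
Proof.
move=> pd eps0.
suff H u v : exists s, e u v -> last (pos u) s = pos v /\
    polypath (fun a b => (arc u v @` `[0, 1]) a /\ ball a eps b) (pos u) s.
  have [E EP] := choice (fun p => H p.1 p.2).
  by exists (fun u v => E (u, v)) => u v; exact: (EP (u, v)).
have [euv|nuv] := boolP (e u v); last by exists [::].
have [|||s [us sv]] := @connected_polypath _ (arc u v @` `[0, 1])
  (fun a b => (arc u v @` `[0, 1]) a /\ ball a eps b) (pos u) (pos v)
  (arc_connected pd euv); last by exists s.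
- exists 0; last exact: (arc_source pd euv).
  by rewrite /= in_itv /= lexx ler01.
- exists 1; last exact: (arc_target pd euv).
  by rewrite /= in_itv /= lexx ler01.
move=> a Ka; apply/nbhs_ballP; exists eps => // b ab Kb; split=> //.
by split=> //; exact: ball_sym.
Qed.

(** Compactness gives a [d] that separates disjoint edges, as well as each [g u] from the edges not
    incident to [u]. Polygonal paths with steps below [d / 2] stay within [d / 2] of their arcs, so
    they inherit the disjointness. *)
Lemma outerplanar_parity_drawn (R : realType) (V : finType) (e : rel V) :
  outerplanar R e -> exists2 t : rel V, tournament t & parity_drawn e t.
Proof.
case=> pos [arc [pd out]].
have [P [g gP]] := outer_paths pd out.
pose K u v := arc u v @` `[0, 1].
have cK u v : e u v -> closed (K u v).
  by move=> euv; apply: plane_compact_closed; exact: arc_compact pd euv.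
have near_edges : \forall d \near (0 : R)^'+, forall p : V * V * V * V,
    [&& e p.1.1.1 p.1.1.2, e p.1.2 p.2 &
      [&& p.1.1.1 != p.1.2, p.1.1.1 != p.2, p.1.1.2 != p.1.2 & p.1.1.2 != p.2]] ->
    forall a b, K p.1.1.1 p.1.1.2 a -> K p.1.2 p.2 b -> ~ ball a d b.
  apply: (@near_finite_imp _ (V * V * V * V)%type 0^'+
    [pred p | [&& e p.1.1.1 p.1.1.2, e p.1.2 p.2 &
      [&& p.1.1.1 != p.1.2, p.1.1.1 != p.2, p.1.1.2 != p.1.2 & p.1.1.2 != p.2]]]
    (fun p d => forall a b, K p.1.1.1 p.1.1.2 a -> K p.1.2 p.2 b -> ~ ball a d b)).
  move=> [[[u v] w] x] /= /and3P[euv ewx n].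
  apply: compact_closed_separated; [exact: arc_compact pd euv|exact: cK|].
  by move=> z; exact: (arcs_disjoint pd euv ewx n).
have near_paths : \forall d \near (0 : R)^'+, forall p : V * V * V,
    [&& e p.1.2 p.2, p.1.1 != p.1.2 & p.1.1 != p.2] ->
    polypath (fun a b => forall c z, K p.1.2 p.2 c -> segset a b z -> ~ ball c d z)
      (pos p.1.1) (g p.1.1).
  apply: (@near_finite_imp _ (V * V * V)%type 0^'+
    [pred p | [&& e p.1.2 p.2, p.1.1 != p.1.2 & p.1.1 != p.2]]
    (fun p d => polypath
       (fun a b => forall c z, K p.1.2 p.2 c -> segset a b z -> ~ ball c d z)
       (pos p.1.1) (g p.1.1))).
  move=> [[u w] x] /= /and3P[ewx uw ux]; apply: near_polypath.
  apply: polypath_impl (gP u).2 => a b H; apply: compact_closed_separated.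
  - exact: arc_compact pd ewx.
  - by apply: plane_compact_closed; exact: segset_compact.
  - by move=> z Kz sz; exact: (H w x ewx uw ux z sz Kz).
have [d [[d0 dK] dg]] :=
  filter_ex (filterI (filterI (nbhs_right_gt (0 : R)) near_edges) near_paths).
have [E EP] := edge_polypath pd (divr_gt0 d0 (ltr0n R 2)).
have half (a b z : R * R) : ball a (d / 2) z -> ball b (d / 2) z -> ball a d b.
  by move=> az bz; rewrite (splitr d); apply: ball_triangle az (ball_sym bz).
have E0 a b t : 0 <= t <= 1 -> ball a (d / 2) b -> ball a (d / 2) (segpt t a b).
  move=> t01 ab; apply: ball_segpt => //; apply: ballxx.
  by rewrite divr_gt0.
have gE u w x : e w x -> u != w -> u != x ->
    polypath (fun a b => polypath (segs_disjoint a b) (pos w) (E w x)) (pos u) (g u).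
  move=> ewx uw ux; apply: polypath_impl (dg (u, w, x) _) => [/= a b H|];
    last by rewrite /= ewx uw.
  apply: polypath_impl (EP w x ewx).2 => c f [Kc cf] s t s01 t01 st.
  apply: (H c (segpt t c f) Kc); first by rewrite -st; exists s.
  apply: le_ball (E0 _ _ _ t01 cf); lra.
have EE u v w x : e u v -> e w x -> [&& u != w, u != x, v != w & v != x] ->
    polypath (fun a b => polypath (segs_disjoint a b) (pos w) (E w x)) (pos u) (E u v).
  move=> euv ewx n; apply: polypath_impl (EP u v euv).2 => a b [Ka ab].
  apply: polypath_impl (EP w x ewx).2 => c f [Kc cf] s t s01 t01 st.
  apply: (dK (u, v, w, x) _ a c Ka Kc) => /=; first by rewrite euv ewx.
  apply: half (E0 _ _ _ s01 ab) _.
  by rewrite st; exact: E0.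
pose A u w := crossings (pos w) (pos u) (g u) (+) lexpos (pos w - pos u).
(* The [A] terms are symmetric in [u] and [w]; the [lexpos] term changes when they are exchanged,
   which makes this a tournament. *)
exists (fun u w => A u w (+) A w u (+) lexpos (pos w - pos u)).
  move=> u w uw; rewrite -(opprB (pos u)) lexposN; first by rewrite addbN (addbC (A u w)).
  by rewrite subr_eq0; apply: contra_neq uw; exact: (pos_inj pd).
move=> u v w x euv ewx n; have := n => /and4P[uw ux vw vx].
have [wu xu wv xv] : [/\ w != u, x != u, w != v & x != v].
  by rewrite ![w == _]eq_sym ![x == _]eq_sym.
have Lg z : last (pos z) (g z) = P by case: (gP z).
have LE y z : e y z -> last (pos y) (E y z) = pos z by move=> /EP[].
have := crossings_polypath (gE u w x ewx uw ux).
have := crossings_polypath (gE v w x ewx vw vx).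
have := crossings_polypath (gE w u v euv wu wv).
have := crossings_polypath (gE x u v euv xu xv).
have := crossings_polypath (EE u v w x euv ewx n).
rewrite !Lg !LE // -/(A u w) -/(A u x) -/(A v w) -/(A v x) -/(A w u) -/(A w v)
  -/(A x u) -/(A x v) => H1 H2 H3 H4 H5.
apply: (addb_transfer H1); apply: (addb_transfer H2); apply: (addb_transfer H3).
apply: (addb_transfer H4); apply: (addb_transfer H5).
by rewrite !addbE; btauto.
Qed.

Theorem theorem5 (R : realType) (V : finType) (e : rel V)
  (Gsimple : simple_graph e) (Gconnected : connected_graph e)
  (Gouter : outerplanar R e) : cAnd1 R e.
Proof.
have [t tt pt] := outerplanar_parity_drawn Gouter.
exact: parity_drawn_cAnd1 tt pt.
Qed.
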